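(* For every integer $k\ge 1$, $\alpha(k,k+2)$ is the string $0\,1\,2\,3\cdots(k-1)\,k\,k$ of length $k+2$, where $\alpha(k,p)$ denotes the lexicographically minimal critical string of a $k$-mismatch search scheme with $p$ parts (definitions in the context).
   Context: Fix integers $k\ge 0$ and $p\ge 1$. A search (with $p$ parts and at most $k$ errors) is a triple $S=(\pi,L,U)$ where $\pi=\pi(1)\cdots\pi(p)$ is a permutation of $\{1,\dots,p\}$ written as a string and satisfying the connectivity property: for every $i>1$, $\pi(i)$ equals either $\min_{j<i}\pi(j)-1$ or $\max_{j<i}\pi(j)+1$; and $L,U$ are strings of length $p$ over $\{0,\dots,k\}$. For a string $A$ of length $p$ over the nonnegative integers, its weight is $\sum_i A[i]$. The search $S$ covers $A$ if $L[i+1]\le \sum_{j=1}^{i} A[\pi(j)]\le U[i]$ for all $i=1,\dots,p$, with the convention $L[p+1]=0$. A $k$-mismatch search scheme with $p$ parts is a finite set $\mathcal S$ of such searches such that every string $A$ of length $p$ over the nonnegative integers of weight exactly $k$ is covered by some search in $\mathcal S$. The critical string of $\mathcal S$ is the lexicographically maximal $U$-string among the searches of $\mathcal S$. $\alpha(k,p)$ is the lexicographically minimal critical string over all $k$-mismatch search schemes with $p$ parts. *)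

(* Defs.v *)
From HB Require Import structures.
From mathcomp Require Import all_boot all_order all_fingroup.

Set Implicit Arguments.
Unset Strict Implicit.
Unset Printing Implicit Defensive.

(* Everything is indexed from 0: the parts are the elements of 'I_p, and the  *)
(* i-th letter (i = 1, ..., p) of a string is its entry at index i - 1.       *)

(* (pi i).+1 = min is pi(i) = min - 1 without truncated subtraction.  The     *)
(* default values p and 0 of the iterated min and max are immaterial, since   *)
(* the range j < i is nonempty and all values are smaller than p.             *)
Definition connectivity (p : nat) (pi : {perm 'I_p}) : bool :=
  [forall i : 'I_p, (0 < i) ==>
     (((pi i).+1 == \big[minn/p]_(j < p | j < i) (pi j : nat))
      || ((pi i : nat) == (\max_(j < p | j < i) (pi j : nat)).+1))].

Record search (k p : nat) : Type := Search {
  search_val : {perm 'I_p} * p.-tuple 'I_k.+1 * p.-tuple 'I_k.+1;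
  _ : connectivity search_val.1.1
}.

HB.instance Definition _ (k p : nat) := [isSub for @search_val k p].
HB.instance Definition _ (k p : nat) := [Finite of search k p by <:].

Definition search_perm (k p : nat) (s : search k p) : {perm 'I_p} :=
  (search_val s).1.1.
Definition lower (k p : nat) (s : search k p) : seq nat :=
  [seq val x | x <- (search_val s).1.2].
Definition upper (k p : nat) (s : search k p) : seq nat :=
  [seq val x | x <- (search_val s).2].

Definition weight (p : nat) (A : p.-tuple nat) : nat := \sum_(i < p) tnth A i.

(* For the last index, nth 0 reads past the end of the lower string, which    *)
(* gives exactly the convention L[p + 1] = 0.                                 *)
Definition covers (k p : nat) (s : search k p) (A : p.-tuple nat) : Prop :=
  forall i : 'I_p,
    nth 0 (lower s) i.+1 <= \sum_(j < p | j <= i) tnth A (search_perm s j)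
      <= nth 0 (upper s) i.

Definition search_scheme (k p : nat) (S : {set search k p}) : Prop :=
  forall A : p.-tuple nat, weight A = k -> exists2 s, s \in S & covers s A.

Definition critical_string (k p : nat) (S : {set search k p}) (u : seq nat) :
    Prop :=
  (exists2 s, s \in S & upper s = u)
  /\ (forall s, s \in S -> (upper s <= u :> seqlexi nat)%O).

(* The string alpha(k, p), as a relation; it is functional by is_alpha_inj.   *)
Definition is_alpha (k p : nat) (u : seq nat) : Prop :=
  (exists2 S : {set search k p}, search_scheme S & critical_string S u)
  /\ (forall (S : {set search k p}) (v : seq nat),
        search_scheme S -> critical_string S v -> (u <= v :> seqlexi nat)%O).

Lemma is_alpha_inj (k p : nat) (u v : seq nat) :
  is_alpha k p u -> is_alpha k p v -> u = v.
Proof.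
case=> [[S Ss Su] umin] [[T Ts Tv] vmin].
apply: (@Order.POrderTheory.le_anti _ (seqlexi nat)); apply/andP; split.
  exact: umin Tv.
exact: vmin Su.
Qed.

(* Main.v *)
(* Subtracting 1 from every letter of a string of weight k and length k + 2
   leaves letters at least -1 with sum -2, so two zeros of the string are
   separated by ones only.  Reading from the left one of these zeros to the
   right, and then the remaining parts leftwards, gives the partial sums
   0, 1, ..., m, m, which are lexicographically at most 0 1 ... k k; a search
   taking its own partial sums as U-string covers the string.  Conversely, a
   search covering 0 1 ... 1 0 either starts inside, so that U[1] >= 1, or reads
   the string from one end to the other, with partial sums 0, 1, ..., k, k. *)
Require Import Defs.
From mathcomp Require Import all_boot all_order all_fingroup.
From mathcomp Require Import zify.

Set Implicit Arguments.
Unset Strict Implicit.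
Unset Printing Implicit Defensive.

(** * Lexicographic comparison and strings of small weight *)

(** The first index where the strings differ is at most [m], and [s] is smaller there. With
    [m = size s] the strict condition is vacuous and the comparison is pointwise. *)
Lemma lexi_leP (s t : seq nat) (m : nat) :
    size s = size t ->
    (forall i, i < m -> nth 0 s i <= nth 0 t i) ->
    (m < size s -> nth 0 s m < nth 0 t m) ->
  (s <= t :> seqlexi nat)%O.
Proof.
elim: s t m => [|x s IHs] [|y t] [|m] //= [sz_st] le_st lt_st.
  rewrite Order.SeqLexiOrder.Exports.lexi_cons !leEnat; have := lt_st isT.
  by case: ltngtP.
rewrite Order.SeqLexiOrder.Exports.lexi_cons !leEnat (le_st 0 isT) /=.
apply/implyP => _; apply: (IHs t m) => // i lt_im.
exact: (le_st i.+1).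
Qed.

Lemma zeros_separated_by_ones (s : seq nat) :
    sumn s + 2 <= size s ->
  exists a m, a + m.+1 < size s /\
    forall i, i <= m.+1 -> nth 0 s (a + i) = (0 < i <= m).
Proof.
pose zeros s := exists a m, a + m.+1 < size s /\
  forall i, i <= m.+1 -> nth 0 s (a + i) = (0 < i <= m).
have zeros_cons x t : zeros t -> zeros (x :: t).
  by move=> [a [m [lt_am eq_s]]]; exists a.+1, m; split=> // i /eq_s.
(* The induction also carries strings with surplus one: without a block [0 1 ... 1 0] they begin
   with [1 ... 1 0], which a zero put in front completes to such a block. *)
suff [] : (sumn s + 2 <= size s -> zeros s) /\
  (sumn s + 1 <= size s -> zeros s \/
     exists2 m, m < size s & forall i, i <= m -> nth 0 s i = (i < m)) by [].
elim: s => [|x s [IH2 IH1]]; first by split.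
split=> /= le_s.
  case: x => [|x] in le_s *; last by apply/zeros_cons/IH2; lia.
  case: IH1 => [|/zeros_cons //|[m lt_m eq_s]]; first by lia.
  exists 0, m; split; first by rewrite /=; lia.
  by case=> [|i] //= /eq_s.
(* A leading 0 is itself the prefix with [m = 0], a leading 1 lengthens the prefix, and a letter at
   least 2 leaves a tail with surplus two. *)
case: x => [|[|x]] in le_s *.
- by right; exists 0 => // -[].
- case: IH1 => [|/zeros_cons|[m lt_m eq_s]]; [lia | by left |].
  by right; exists m.+1 => // -[|i] //= /eq_s.
- by left; apply/zeros_cons/IH2; lia.
Qed.

Lemma sum_ones_between (p i m : nat) :
  i < p -> \sum_(j < p | j <= i) (0 < j <= m : nat) = minn i m.
Proof.
case: p => [//|p] le_ip; rewrite (big_ord_narrow_leq (le_ip : i <= p)) /=.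
elim: i {le_ip} => [|i IHi]; first by rewrite big_ord_recl big_ord0 min0n.
by rewrite big_ord_recr /= IHi; lia.
Qed.

(** * Permutations reading rightwards, then leftwards *)

Lemma bigmin_attained (I : finType) (P : pred I) (F : I -> nat) (n : nat)
    (j : I) :
    P j -> F j <= n -> (forall i, P i -> F j <= F i) ->
  \big[minn/n]_(i | P i) F i = F j.
Proof.
move=> Pj le_n le_F; apply/eqP; rewrite eqn_leq -minEnat.
apply/andP; split; first exact: (Order.TotalTheory.bigmin_le_cond _ F Pj).
exact: (@Order.POrderTheory.le_bigmin _ nat).
Qed.

Lemma bigmax_attained (I : finType) (P : pred I) (F : I -> nat) (j : I) :
    P j -> (forall i, P i -> F i <= F j) ->
  \max_(i | P i) F i = F j.
Proof.
move=> Pj le_F; apply/eqP; rewrite eqn_leq leq_bigmax_cond // andbT.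
exact/bigmax_leqP.
Qed.

(** The order [a, a+1, ..., p-1, a-1, ..., 0]; for [p <= a] it is the reversal, so it is a
    permutation for every [a]. *)
Definition sweep_nat (p a i : nat) : nat :=
  if a + i < p then a + i else p - i.+1.

Lemma sweep_nat_lt (p a : nat) (i : 'I_p) : sweep_nat p a i < p.
Proof. by rewrite /sweep_nat; have := ltn_ord i; case: ifP => //; lia. Qed.

Definition sweep_fun (p a : nat) (i : 'I_p) : 'I_p :=
  Ordinal (sweep_nat_lt a i).

Lemma sweep_fun_inj (p a : nat) : injective (@sweep_fun p a).
Proof.
move=> i j /(congr1 val) /=; rewrite /sweep_nat => eq_ij; apply: val_inj => /=.
have := ltn_ord i; have := ltn_ord j.
by move: eq_ij; case: ifP; case: ifP; lia.
Qed.

Definition sweep (p a : nat) : {perm 'I_p} := perm (@sweep_fun_inj p a).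

Lemma sweepE (p a : nat) (i : 'I_p) : sweep p a i = sweep_nat p a i :> nat.
Proof. by rewrite permE. Qed.

Lemma sweep_connectivity (p a : nat) : connectivity (sweep p a).
Proof.
apply/forallP => i; apply/implyP => i_gt0.
have lt_ip := ltn_ord i; have lt_i1 : i.-1 < p by lia.
have lt_i1i : Ordinal lt_i1 < i by rewrite /=; lia.
apply/orP; case: (ltnP (a + i) p) => [lt_ai | le_ai].
  right; rewrite (bigmax_attained (j := Ordinal lt_i1)) //.
    by rewrite !sweepE /sweep_nat /=; do 2 case: ifP; lia.
  by move=> j lt_ji; rewrite !sweepE /sweep_nat /=; do 2 case: ifP; lia.
(* At the turn the minimum so far is the starting part [a], read at index 0; afterwards it is the
   part read just before. *)
left; case: (ltnP (a + i.-1) p) => [lt_ai1 | le_ai1].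
  have lt_0 : 0 < p by lia.
  rewrite (bigmin_attained (j := Ordinal lt_0)) //.
  - by rewrite !sweepE /sweep_nat /=; do 2 case: ifP; lia.
  - exact: ltnW.
  - by move=> j lt_ji; rewrite !sweepE /sweep_nat /=; do 2 case: ifP; lia.
rewrite (bigmin_attained (j := Ordinal lt_i1)) //.
- by rewrite !sweepE /sweep_nat /=; do 2 case: ifP; lia.
- exact: ltnW.
- by move=> j lt_ji; rewrite !sweepE /sweep_nat /=; do 2 case: ifP; lia.
Qed.

(** * Searches built from the partial sums of a string *)

Definition partial_sum (p : nat) (pi : {perm 'I_p}) (A : p.-tuple nat)
    (i : nat) : nat :=
  \sum_(j < p | j <= i) tnth A (pi j).

Lemma partial_sum_weight (p : nat) (pi : {perm 'I_p}) (A : p.-tuple nat)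
    (i : nat) :
  partial_sum pi A i <= weight A.
Proof.
rewrite /weight (reindex_inj (@perm_inj _ pi)) /partial_sum big_mkcond /=.
by apply: leq_sum => j _; case: ifP.
Qed.

(** Lower bounds 0 constrain nothing, and the upper bounds are the least possible for this order.
    When [A] has weight [k], all partial sums are at most [k], so [inord] preserves them. *)
Definition tight_search (k p : nat) (pi : {perm 'I_p})
    (pi_conn : connectivity pi) (A : p.-tuple nat) : search k p :=
  @Search k p (pi, [tuple ord0 | _ < p],
                   [tuple inord (partial_sum pi A i) | i < p]) pi_conn.

Lemma size_upper (k p : nat) (s : search k p) : size (upper s) = p.
Proof. by rewrite size_map size_tuple. Qed.

Lemma nth_upper_tight (k p : nat) (pi : {perm 'I_p})
    (pi_conn : connectivity pi) (A : p.-tuple nat) (i : nat) :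
    weight A = k -> i < p ->
  nth 0 (upper (tight_search k pi_conn A)) i = partial_sum pi A i.
Proof.
move=> wA lt_ip; rewrite (nth_map ord0) ?size_tuple //.
rewrite -[i]/(val (Ordinal lt_ip)) -tnth_nth tnth_mktuple /= inordK //.
by rewrite ltnS -wA partial_sum_weight.
Qed.

Lemma tight_search_covers (k p : nat) (pi : {perm 'I_p})
    (pi_conn : connectivity pi) (A : p.-tuple nat) :
  weight A = k -> covers (tight_search k pi_conn A) A.
Proof.
move=> wA i; rewrite nth_upper_tight // leqnn andbT.
(* At the last index the lower string is read past its end, where the default 0 is the convention
   for L[p + 1]. *)
case: (ltnP i.+1 p) => [lt_ip | le_pi]; last first.
  by rewrite nth_default // size_map size_tuple.
rewrite (nth_map ord0) ?size_tuple //.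
by rewrite -[i.+1]/(val (Ordinal lt_ip)) -tnth_nth tnth_mktuple.
Qed.

(** * Connected permutations from an end, and the lower bound *)

(** The minimum stays 0 and cannot be lowered, so every step must go to the maximum plus one. *)
Lemma perm_ord0_id (p : nat) (pi : {perm 'I_p}) :
    connectivity pi ->
    (forall i : 'I_p, i = 0 :> nat -> pi i = 0 :> nat) ->
  forall i : 'I_p, pi i = i :> nat.
Proof.
move=> /forallP pi_conn pi0 [n lt_np].
elim/ltn_ind: n lt_np => -[|n] IHn lt_np; first exact: pi0.
have lt_0 : 0 < p by lia.
have lt_n : n < p by lia.
have := pi_conn (Ordinal lt_np); rewrite /= => /orP [] /eqP eq_pi; last first.
  rewrite eq_pi (bigmax_attained (j := Ordinal lt_n)) /= ?IHn //.
  by move=> [j lt_jp] /= lt_jn; rewrite IHn.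
move: eq_pi.
by rewrite (bigmin_attained (j := Ordinal lt_0)) //= ?(pi0 (Ordinal lt_0)).
Qed.

(** Mirror image: the maximum is already [p - 1], so every step must go to the minimum minus one. *)
Lemma perm_ord_max_rev (p : nat) (pi : {perm 'I_p}) :
    connectivity pi ->
    (forall i : 'I_p, i = 0 :> nat -> (pi i).+1 = p) ->
  forall i : 'I_p, pi i = p - i.+1 :> nat.
Proof.
move=> /forallP pi_conn pi0 [n lt_np].
elim/ltn_ind: n lt_np => -[|n] IHn lt_np.
  by have := pi0 (Ordinal lt_np) erefl; rewrite /=; lia.
have lt_0 : 0 < p by lia.
have lt_n : n < p by lia.
have := pi_conn (Ordinal lt_np); rewrite /= => /orP [] /eqP eq_pi; last first.
  have := ltn_ord (pi (Ordinal lt_np)).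
  rewrite eq_pi (bigmax_attained (j := Ordinal lt_0)) //=.
    by rewrite (pi0 (Ordinal lt_0)) ?ltnn.
  move=> j _.
  by rewrite -ltnS (pi0 (Ordinal lt_0)).
rewrite (bigmin_attained (j := Ordinal lt_n)) /= ?(IHn n) //= in eq_pi *.
- by lia.
- exact: leq_subr.
- by move=> [j lt_jp] /= lt_jn; rewrite IHn //=; lia.
Qed.

Definition zero_ones_zero (k : nat) : k.+2.-tuple nat :=
  [tuple (0 < i <= k : nat) | i < k.+2].

Lemma weight_zero_ones_zero (k : nat) : weight (zero_ones_zero k) = k.
Proof.
rewrite /weight (eq_bigr (fun i : 'I_k.+2 => (0 < i <= k : nat))).
  rewrite (eq_bigl (fun i : 'I_k.+2 => i <= k.+1)).
    by rewrite sum_ones_between //; lia.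
  by move=> i; rewrite -ltnS ltn_ord.
by move=> i _; rewrite tnth_mktuple.
Qed.

Lemma nth_alpha (k i : nat) :
  i < k.+2 -> nth 0 (rcons (iota 0 k.+1) k) i = minn i k.
Proof.
move=> lt_i; rewrite nth_rcons size_iota.
case: ltngtP => // [lt_ik | lt_ki | ->]; [|lia..].
by rewrite nth_iota //; lia.
Qed.

Lemma cover_zero_ones_zero (k : nat) (s : search k k.+2) :
    0 < k -> covers s (zero_ones_zero k) ->
  (rcons (iota 0 k.+1) k <= upper s :> seqlexi nat)%O.
Proof.
move=> k_gt0 cov_s.
have size_s : size (rcons (iota 0 k.+1) k) = size (upper s).
  by rewrite size_upper size_rcons size_iota.
have sums_le i : i < k.+2 ->
    partial_sum (search_perm s) (zero_ones_zero k) i <= nth 0 (upper s) i.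
  by move=> lt_i; have /andP [] := cov_s (Ordinal lt_i).
(* The string is a palindrome, so reading it from either end gives the string itself; one
   computation of partial sums serves both ends. *)
have end_case : (forall i : 'I_k.+2,
      (0 < search_perm s i <= k) = (0 < i <= k)) ->
    (rcons (iota 0 k.+1) k <= upper s :> seqlexi nat)%O.
  move=> end_s; apply: (@lexi_leP _ _ k.+2) => // [i lt_i|]; last first.
    by rewrite size_rcons size_iota ltnn.
  rewrite nth_alpha //; apply: leq_trans (sums_le i lt_i).
  rewrite -(sum_ones_between k lt_i) leq_eqVlt; apply/orP; left; apply/eqP.
  by apply: eq_bigr => j _; rewrite tnth_mktuple end_s.
(* Starting on a one forces the first upper bound to be positive, which settles the comparison at
   index 0. *)
have [mid_s | end_s] := boolP (0 < search_perm s ord0 <= k).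
  apply: (@lexi_leP _ _ 0) => // _.
  rewrite nth_alpha // min0n; apply: leq_trans (sums_le 0 isT).
  by rewrite /partial_sum (bigD1 ord0) //= tnth_mktuple mid_s.
have pi_conn : connectivity (search_perm s) by case: (s).
apply: end_case => i.
have [pi0 | pi0_gt0] := posnP (search_perm s ord0).
  rewrite (perm_ord0_id pi_conn) // => j j0.
  by rewrite (_ : j = ord0) //; apply: val_inj.
rewrite (perm_ord_max_rev pi_conn) => [|j j0]; first by have := ltn_ord i; lia.
rewrite (_ : j = ord0); last exact: val_inj.
by have := ltn_ord (search_perm s ord0); lia.
Qed.

(** * The upper bound and the optimal scheme *)

Lemma small_cover (k : nat) (A : k.+2.-tuple nat) :
    weight A = k ->
  exists2 s : search k k.+2, covers s A &
    (upper s <= rcons (iota 0 k.+1) k :> seqlexi nat)%O.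
Proof.
move=> wA.
have sumA : sumn A = k by rewrite sumnE big_tuple.
have [|a [m [lt_am eq_A]]] := @zeros_separated_by_ones A.
  by rewrite sumA size_tuple; lia.
rewrite size_tuple in lt_am.
exists (tight_search k (@sweep_connectivity k.+2 a) A).
  exact: tight_search_covers.
have sums i : i <= m.+1 -> partial_sum (sweep k.+2 a) A i = minn i m.
  move=> le_im; have lt_i : i < k.+2 by lia.
  rewrite -(sum_ones_between m lt_i); apply: eq_bigr => j le_ji.
  rewrite (tnth_nth 0) sweepE /sweep_nat ifT; last by lia.
  by rewrite eq_A //; lia.
have nth_sweep i : i <= m.+1 ->
    nth 0 (upper (tight_search k (@sweep_connectivity k.+2 a) A)) i = minn i m.
  by move=> le_im; rewrite nth_upper_tight ?sums //; lia.
have size_s : size (upper (tight_search k (@sweep_connectivity k.+2 a) A)) =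
    size (rcons (iota 0 k.+1) k).
  by rewrite size_upper size_rcons size_iota.
(* If [m < k], the sums repeat [m] at index [m.+1], where the target has [m.+1]. Otherwise the block
   fills the whole string and the sums agree with the target everywhere. *)
have [lt_mk | le_km] := ltnP m k.
  apply: (@lexi_leP _ _ m.+1) => // [i lt_im | lt_m].
    by rewrite nth_sweep ?nth_alpha; lia.
  by rewrite nth_sweep // nth_alpha; lia.
apply: (@lexi_leP _ _ k.+2) => // [i lt_ik |]; last by rewrite size_upper ltnn.
by rewrite nth_sweep ?nth_alpha; lia.
Qed.

Theorem theorem2 (k : nat) (hk : 1 <= k) :
  is_alpha k k.+2 (rcons (iota 0 k.+1) k).
Proof.
split; last first.
  move=> S v /(_ _ (weight_zero_ones_zero k)) [s sS cov_s] [_ /(_ s sS) le_sv].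
  exact: Order.POrderTheory.le_trans (cover_zero_ones_zero hk cov_s) le_sv.
(* The largest candidate is taken: all searches whose upper string does not exceed the target. *)
pose low_searches :=
  [set s : search k k.+2 |
    (upper s <= rcons (iota 0 k.+1) k :> seqlexi nat)%O].
exists low_searches.
  by move=> A /small_cover [s cov_s le_s]; exists s; rewrite ?inE.
split; last by move=> s; rewrite inE.
(* The target is attained: a search in the scheme covering [0 1 ... 1 0] has an upper string bounded
   by it on both sides. *)
have [s cov_s le_s] := small_cover (weight_zero_ones_zero k).
exists s; first by rewrite inE.
apply: (@Order.POrderTheory.le_anti _ (seqlexi nat)).
by rewrite le_s cover_zero_ones_zero.
Qed.
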